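(* (i) For all sufficiently large positive integers $k$, there is no positive integer $n\le \frac{3}{8}k^2+\frac12$ and word $\sigma\in[k]^n$ such that every $\tau\in S_k$ is a bi-directional circular pattern of $\sigma$. (ii) More strongly, there is a sequence of non-negative reals $\eta_k\to 0$ such that for every positive integer $k$: if $\sigma\in[k]^n$ is a word such that every $\tau\in S_k$ is a bi-directional circular pattern of $\sigma$, then $n\ge \frac{k^2}{2}-k^{7/4+\eta_k}$.
   Context: For a positive integer $m$, $[m]=\{1,\dots,m\}$, and $S_k$ is the set of permutations of $[k]$. A word $w\in[r]^n$ contains $\tau\in S_k$ as a pattern if there are indices $1\le i_1<\dots<i_k\le n$ such that for all $j,j'\in[k]$, $w(i_j)<w(i_{j'})$ if and only if $\tau(j)<\tau(j')$. A permutation $\tau\in S_k$ is a circular pattern of $w\in[r]^n$ if there is $i\in[n]$ such that $\tau$ is contained as a pattern in the rotated word $w(i),w(i+1),\dots,w(n),w(1),w(2),\dots,w(i-1)$. A permutation $\tau\in S_k$ is a bi-directional circular pattern of $w$ if $\tau$ is a circular pattern of $w$ or of its reversal $w(n),w(n-1),\dots,w(1)$ (or both). *)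

(* Defs.v *)
From HB Require Import structures.
From mathcomp Require Import all_boot all_order all_algebra all_fingroup.
From mathcomp Require Import all_classical all_reals all_analysis.
Set Implicit Arguments.
Unset Strict Implicit.
Unset Printing Implicit Defensive.

(* Words in [r]^n are tuples n.-tuple 'I_r, with letters, positions and the
   entries of permutations numbered from 0; only their relative order matters. *)

Definition contains_pattern (n r k : nat) (w : n.-tuple 'I_r) (tau : 'S_k)
    : Prop :=
  exists i : 'I_k -> 'I_n,
    (forall j j' : 'I_k, (j < j')%N -> (i j < i j')%N) /\
    (forall j j' : 'I_k,
       (tnth w (i j) < tnth w (i j'))%N <-> (tau j < tau j')%N).

Definition circular_pattern (n r k : nat) (w : n.-tuple 'I_r) (tau : 'S_k)
    : Prop :=
  exists i : 'I_n, contains_pattern [tuple of rot i w] tau.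

Definition bidirectional_circular_pattern (n r k : nat) (w : n.-tuple 'I_r)
    (tau : 'S_k) : Prop :=
  circular_pattern w tau \/ circular_pattern [tuple of rev w] tau.

(* Main.v *)
Require Import Defs.
From HB Require Import structures.
From mathcomp Require Import all_boot all_order all_algebra all_fingroup.
From mathcomp Require Import all_classical all_reals all_analysis.
From mathcomp Require Import ring lra zify.
Import Order.TTheory GRing.Theory Num.Theory.
Import numFieldNormedType.Exports.
Local Open Scope ring_scope.

(** Cut a uniformly random permutation into [k / b] blocks of [b ~ sqrt k]
    consecutive entries. A random word of length [b] with independent letters
    typically needs a stretch of length about [b k / 2] to be found as a
    subsequence, since the next occurrences of the [k] letters have distinct
    positions; an exponential moment makes this quantitative. For [2 b^2 <= k]
    a positive proportion of the words of length [b] have distinct letters, so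
    the same holds for each block of the permutation, and a union bound over
    all blocks, all [2n] rotations and all starting positions yields one
    permutation each of whose blocks occupies at least
    [b k / 2 - O(k sqrt b ln k)] letters wherever it is embedded.
    Summing over the blocks gives [n >= k^2 / 2 - O(k^(7/4) ln k)]. *)

Set Implicit Arguments.
Unset Strict Implicit.

(** * Counting the words embedded in a given word *)

Lemma subseq_cons_index (T : eqType) (a : T) (u z : seq T) :
  subseq (a :: u) z = (a \in z) && subseq u (drop (index a z).+1 z).
Proof.
elim: z => //= y z IH.
by rewrite inE [y == a]eq_sym; case: (eqVneq a y) => [->|ne] //=; rewrite drop0.
Qed.

Lemma subseq_cat_split (T : eqType) (s1 s2 v : seq T) :
  subseq (s1 ++ s2) v ->
  exists2 p, (p <= size v)%N & subseq s1 (take p v) && subseq s2 (drop p v).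
Proof.
elim: v s1 => [|y v IH] [|x s1] //=.
- by case: s2 => // _; exists 0%N.
- by move=> h; exists 0%N.
- case: eqP => [->|ne] h.
  + have [p pv hp] := IH _ h; exists p.+1 => //=; by rewrite eqxx.
  + have [p pv hp] := IH (x :: s1) h; exists p.+1 => //=.
    by move: hp; case: eqP ne.
Qed.

(** Powers of [x] decrease, so distinct exponents do best as an initial segment. An exponent at
    least [k] is traded for [k] itself; if there is none, [s] has at most [k] entries and the term
    [x ^+ k] is to spare. *)
Lemma sum_exp_uniq_le (R : numDomainType) (x : R) (k : nat) (s : seq nat) :
  0 <= x <= 1 -> uniq s -> (size s <= k)%N ->
  \sum_(j <- s) x ^+ j <= \sum_(j < k) x ^+ j.
Proof.
move=> /andP[x0 x1]; elim: k s => [|k IH] s us.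
  by rewrite leqn0 size_eq0 => /eqP ->; rewrite big_nil big_ord0.
move=> ss; rewrite big_ord_recr /=.
have [/hasP[j js kj]|/hasPn hs] := boolP (has (fun j => (k <= j)%N) s).
  rewrite (perm_big _ (perm_to_rem js)) big_cons [leLHS]addrC lerD //.
    by apply: IH; rewrite ?rem_uniq // size_rem //; case: (size s) ss.
  by rewrite ler_wiXn2l.
rewrite -[leLHS]addr0; apply: lerD; last exact: exprn_ge0.
apply: (IH s us).
rewrite -[leqRHS](size_iota 0) uniq_leq_size // => j /hs.
by rewrite mem_iota /= -ltnNge.
Qed.

Definition tuples_in (T : finType) (b : nat) (z : seq T) :=
  [set u : b.-tuple T | subseq u z].

(** Greedy embedding: matching the first letter at its first occurrence loses nothing, so the words
    split by first letter. *)
Lemma card_tuples_inS (T : finType) (b : nat) (z : seq T) :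
  #|tuples_in b.+1 z| =
  (\sum_(a in z) #|tuples_in b (drop (index a z).+1 z)|)%N.
Proof.
rewrite -sum1_card.
rewrite (reindex (fun p : T * b.-tuple T => cons_tuple p.1 p.2)) /=; last first.
  exists (fun u : b.+1.-tuple T => (thead u, behead_tuple u)).
    by case=> a u _; congr pair; apply/val_inj.
  by move=> u _; rewrite [RHS]tuple_eta; apply/val_inj.
under eq_bigl => p do rewrite inE /= subseq_cons_index.
rewrite -(pair_big_dep (fun a => a \in z)
  (fun a (u : b.-tuple T) => subseq u (drop (index a z).+1 z)) (fun _ _ => 1%N)) /=.
apply: eq_bigr => a az; rewrite -sum1_card.
by apply: eq_bigl => u; rewrite inE.
Qed.

(** The exponential moment. In the greedy recursion the first letter [a] costs
    [x ^+ (index a z).+1], and distinct letters have distinct first positions, so each step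
    contributes at most the sum over positions 1 to [#|T|]. *)
Lemma card_tuples_in_exp (R : numDomainType) (x : R) (T : finType) (b : nat)
    (z : seq T) : 0 <= x <= 1 ->
  #|tuples_in b z|%:R * x ^+ size z <= (\sum_(j < #|T|) x ^+ j.+1) ^+ b.
Proof.
move=> x01; have /andP[x0 x1] := x01.
set S := \sum_(j < _) _.
have S0 : 0 <= S by apply: sumr_ge0 => j _; apply: exprn_ge0.
elim: b z => [|b IH] z.
  rewrite expr0 -[leRHS]mul1r ler_pM ?exprn_ge0 ?exprn_ile1 //.
  rewrite (_ : 1 = 1%:R) // ler_nat (leq_trans (max_card _)) //.
  by rewrite card_tuple expn0.
rewrite card_tuples_inS natr_sum mulr_suml exprS.
have -> : \sum_(a in z) #|tuples_in b (drop (index a z).+1 z)|%:R * x ^+ size z =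
   \sum_(a in z) x ^+ (index a z).+1 *
     (#|tuples_in b (drop (index a z).+1 z)|%:R * x ^+ size (drop (index a z).+1 z)).
  apply: eq_bigr => a az; rewrite mulrCA -exprD size_drop subnKC //.
  by rewrite index_mem.
apply: le_trans (_ : \sum_(a in z) x ^+ (index a z).+1 * S ^+ b <= _).
  by apply: ler_sum => a az; rewrite ler_wpM2l ?exprn_ge0.
rewrite -mulr_suml ler_wpM2r ?exprn_ge0 //.
rewrite /S; under eq_bigr do rewrite exprS.
under [leRHS]eq_bigr do rewrite exprS.
rewrite -!mulr_sumr ler_wpM2l //.
rewrite -(big_image _ _ (fun a => index a z) (fun a => a \in z) (fun j => x ^+ j)).
apply: sum_exp_uniq_le => //.
  rewrite map_inj_in_uniq ?enum_uniq // => a a'; rewrite !mem_enum => az a'z e.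
  by rewrite -(nth_index a az) e nth_index.
by rewrite size_map -cardE max_card.
Qed.

(** * Permutations whose blocks avoid a family of short words *)

Lemma card_perm_map_eq (T : finType) (P u : seq T) : uniq P ->
  (#|[set s : {perm T} | map s P == u]| <= (#|T| - size P)`!)%N.
Proof.
move=> uP; set F := [set s | _].
have [->|[s0 s0F]] := set_0Vmem F; first by rewrite cards0.
have -> : (#|T| - size P = #|~: [set x in P]|)%N.
  by rewrite -(cardsC [set x in P]) cardsE (card_uniqP uP) addKn.
rewrite -card_perm.
(* Multiplication by the inverse of one solution [s0] sends all solutions into the permutations
   fixing [P] pointwise. *)
rewrite -(card_imset _ (mulIg s0^-1)%g) subset_leq_card //.
apply/fintype.subsetP => _ /imsetP[s sF ->].
apply/fintype.subsetP => t; rewrite inE permM; apply: contraR.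
rewrite !inE negbK => tP; move: sF s0F; rewrite !inE => /eqP <- /eqP /eq_in_map.
by move=> /(_ _ tP) <-; rewrite permK.
Qed.

Definition block (T : Type) (b j : nat) (s : seq T) := take b (drop (j * b) s).

Lemma exists_perm_avoiding (k b m : nat) (Z : seq (seq 'I_k)) :
  (m * b <= k)%N ->
  (m * \sum_(z <- Z) #|tuples_in b z| < k ^_ b)%N ->
  exists t : 'S_k, forall j z, (j < m)%N -> z \in Z ->
    ~~ subseq (block b j (codom t)) z.
Proof.
move=> mbk small.
have bP j : (j < m)%N -> size (block b j (enum 'I_k)) = b.
  move=> jm; rewrite size_takel // size_drop size_enum_ord leq_subRL.
    by rewrite -mulSnr (leq_trans _ mbk) // leq_mul2r jm orbT.
  by rewrite (leq_trans _ mbk) // leq_mul2r ltnW ?orbT.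
have blockE (t : 'S_k) j : block b j (codom t) = map t (block b j (enum 'I_k)).
  by rewrite /block map_take map_drop.
case: (pickP [pred t : 'S_k | [forall j : 'I_m, all
   (fun z => ~~ subseq (block b j (codom t)) z) Z]]) => [t /forallP ht|bad].
  by exists t => j z jm zZ; have /allP := ht (Ordinal jm); apply.
(* If every permutation were bad, counting triples of a block, a word of [Z] and a tuple embedded in
   it would give this bound, against [k! = k ^_ b * (k - b)!]. *)
suff : (k`! <= (m * \sum_(z <- Z) #|tuples_in b z|) * (k - b)`!)%N.
  have [lkb|lbk] := ltnP k b; first by move: small; rewrite ffact_small.
  by rewrite -(ffact_fact lbk) leqNgt ltn_mul2r small fact_gt0.
have -> : k`! = #|[set: 'S_k]| by rewrite cardsT card_Sn.
rewrite cardsT -sum1_card.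
apply: leq_trans (_ : \sum_(t : 'S_k) \sum_(j < m) \sum_(z <- Z)
   \sum_(u in tuples_in b z) (map t (block b j (enum 'I_k)) == u) <= _)%N.
  apply: leq_sum => t _.
  have /negbT := bad t; rewrite /= negb_forall => /existsP[j /allPn[z zZ]].
  rewrite negbK => sz.
  rewrite (bigD1 j) //= (leq_trans _ (leq_addr _ _)) //.
  rewrite (perm_big _ (perm_to_rem zZ)) big_cons (leq_trans _ (leq_addr _ _)) //.
  have szb : size (map t (block b j (enum 'I_k))) == b by rewrite size_map bP.
  rewrite (bigD1 (Tuple szb)) /= ?eqxx //.
  by rewrite inE /= -blockE.
rewrite exchange_big /= -[X in (_ <= X * _ * _)%N](card_ord m) -sum_nat_const.
rewrite big_distrl; apply: leq_sum => j _ /=.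
rewrite exchange_big big_distrl; apply: leq_sum => z _ /=.
rewrite exchange_big -sum_nat_const; apply: leq_sum => u _ /=.
have uP : uniq (block b j (enum 'I_k)) by rewrite take_uniq ?drop_uniq ?enum_uniq.
have := card_perm_map_eq u uP; rewrite bP // card_ord; apply: leq_trans.
rewrite -sum1_card [leqRHS]big_mkcond; apply: leq_sum => t _.
by rewrite inE; case: eqP.
Qed.

(** Cut [v] where an embedding of the first block ends: that prefix has more than [L] letters. The
    hypothesis covers every start [p], so it passes to the remaining suffix. *)
Lemma size_of_long_blocks (T : eqType) (b m L : nat) (s v : seq T) :
  subseq s v ->
  (forall j p, (j < m)%N -> (p <= size v)%N ->
     ~~ subseq (block b j s) (take L (drop p v))) ->
  (m * L.+1 <= size v)%N.
Proof.
elim: m s v => // m IH s v sv hb.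
move: (sv); rewrite -{1}(cat_take_drop b s) => /subseq_cat_split[p pv /andP[s1 s2]].
have pL : (L < p)%N.
  rewrite ltnNge; apply/negP => pL; have /negP := hb 0%N 0%N isT isT.
  apply; rewrite /block mul0n !drop0 (subseq_trans s1) //.
  have -> : take p v = take p (take L v) by rewrite -take_min (minn_idPl pL).
  exact: take_subseq.
rewrite mulSn -(subnKC pv) leq_add // -size_drop; apply: (IH _ _ s2) => j q jm.
rewrite size_drop => qv; rewrite drop_drop /block drop_drop -mulSnr.
by apply: hb => //; rewrite -(subnK pv) leq_add2r.
Qed.

(** * Bi-directional circular patterns as subsequences of rotations *)

Lemma eq_of_same_order (k : nat) (f g : 'I_k -> 'I_k) : injective g ->
  (forall j j', (f j < f j')%N <-> (g j < g j')%N) -> f =1 g.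
Proof.
move=> ginj fg j.
have fgE a c : (f a < f c)%N = (g a < g c)%N by apply/idP/idP; case: (fg a c).
have finj : injective f.
  move=> a c e; apply: ginj; apply: val_inj; apply/eqP.
  by apply: contraTT isT; rewrite neq_ltn -!fgE e ltnn.
(* An injective self-map of ['I_k] takes at [j] the number of smaller values, which depends on
   relative order only. *)
have cnt (h : 'I_k -> 'I_k) : injective h -> #|[set i | (h i < h j)%N]| = h j.
  move=> hinj; rewrite -(card_imset _ hinj).
  have -> : h @: [set i | (h i < h j)%N] = [set y : 'I_k | (y < h j)%N].
    apply/setP => y; apply/imsetP/idP => [[i]|]; rewrite inE; first by rewrite inE => ? ->.
    by move=> yj; exists (invF hinj y); rewrite ?inE f_invF.
  rewrite -sum1_card; under eq_bigl do rewrite inE.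
  by rewrite -(big_ord_widen _ (fun _ => 1%N)) ?sum1_card ?card_ord // ltnW.
apply: val_inj; rewrite /= -(cnt _ finj) -(cnt _ ginj).
by apply: eq_card => i; rewrite !inE fgE.
Qed.

(** The alphabet has exactly [k] letters, so an occurrence of the pattern must spell [tau]
    itself. *)
Lemma contains_pattern_subseq (n k : nat) (w : n.-tuple 'I_k) (tau : 'S_k) :
  contains_pattern w tau -> subseq (codom tau) w.
Proof.
case=> i [imono iord].
have iE : (fun j => tnth w (i j)) =1 tau by apply: eq_of_same_order perm_inj iord.
rewrite /codom /image_mem -(eq_map iE) (map_comp (tnth w) i).
rewrite -[X in subseq _ X]map_tnth_enum; apply: map_subseq.
have sorted_ord m : sorted (relpre (@nat_of_ord m) ltn) (enum 'I_m).
  by rewrite -sorted_map val_enum_ord iota_ltn_sorted.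
have tr : transitive (relpre (@nat_of_ord n) ltn) by move=> ? ? ?; apply: ltn_trans.
(* Two strictly increasing lists with the same members coincide, and a filtered list is a
   subsequence. *)
suff -> : map i (enum 'I_k) = seq.filter (mem (map i (enum 'I_k))) (enum 'I_n).
  exact: filter_subseq.
apply: (irr_sorted_eq tr) => [x|||x]; first exact: ltnn.
- by rewrite sorted_map; apply: sub_sorted (sorted_ord k) => a b; apply: imono.
- exact: sorted_filter (sorted_ord n).
- by rewrite mem_filter mem_enum andbT.
Qed.

Definition rotations (T : Type) (w : seq T) := [seq rot i w | i <- iota 0 (size w)].

Lemma bidirectional_subseq (n k : nat) (w : n.-tuple 'I_k) (tau : 'S_k) :
  bidirectional_circular_pattern w tau ->
  exists2 v, v \in rotations w ++ rotations (rev w) & subseq (codom tau) v.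
Proof.
case=> -[i /contains_pattern_subseq s].
  exists (rot i w) => //; rewrite mem_cat; apply/orP; left; apply/mapP.
  by exists (i : nat); rewrite // mem_iota size_tuple ltn_ord.
exists (rot i (rev w)) => //; rewrite mem_cat; apply/orP; right; apply/mapP.
by exists (i : nat); rewrite // mem_iota size_rev size_tuple ltn_ord.
Qed.

Lemma universal_word_size (k n b m L M : nat) (w : n.-tuple 'I_k) :
  (m * b <= k)%N ->
  (forall z : seq 'I_k, (size z <= L)%N -> (#|tuples_in b z| <= M)%N) ->
  (m * ((n + n) * n.+1 * M) < k ^_ b)%N ->
  (forall tau : 'S_k, bidirectional_circular_pattern w tau) ->
  (m * L.+1 <= n)%N.
Proof.
move=> mbk few small univ.
pose V := rotations w ++ rotations (rev w).
have sizeV v : v \in V -> size v = n.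
  rewrite mem_cat => /orP[] /mapP[i _ ->]; rewrite size_rot ?size_rev size_tuple //.
(* All windows where a block might sit: [n + n] rotations times [n.+1] starting positions. *)
pose Z := [seq take L (drop p v) | v <- V, p <- iota 0 n.+1].
have [|t ht] := @exists_perm_avoiding k b m Z mbk.
  apply: leq_ltn_trans small; rewrite leq_mul2l; apply/orP; right.
  have -> : ((n + n) * n.+1 = size Z)%N.
    by rewrite size_allpairs size_cat !size_map !size_iota size_rev size_tuple.
  rewrite -(sum1_size Z) big_distrl /= !big_seq; apply: leq_sum => z /allpairsP[[v p] /= [_ _ ->]].
  by rewrite mul1n few // size_take_min geq_minl.
have [v vV tv] := bidirectional_subseq (univ t).
rewrite -(sizeV v vV); apply: size_of_long_blocks tv _ => j p jm pv.
apply: ht => //; apply/allpairsP; exists (v, p); split=> //.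
by rewrite mem_iota ltnS -(sizeV v vV).
Qed.

(** * Tail bound for random words, and the passage to distinct letters *)

Lemma expRN_le_quadratic (R : realType) (y : R) : 0 <= y -> expR (- y) <= 1 - y + y ^+ 2.
Proof.
move=> y0; rewrite expRN; have y1 : 0 < 1 + y by lra.
apply: le_trans (_ : (1 + y)^-1 <= _); first by rewrite lef_pV2 ?posrE ?expR_gt0 ?expR_ge1Dx.
rewrite -[leLHS]mul1r ler_pdivrMr //.
have -> : (1 - y + y ^+ 2) * (1 + y) = 1 + y ^+ 3 by ring.
by rewrite lerDl exprn_ge0.
Qed.

(** A Chernoff bound: falling [k * c * T] short of the typical length [c ^ 2 * k / 2] costs a factor
    [expR (- T)], up to the constant [expR 1]. *)
Lemma card_short_tuples_in (R : realType) (k c : nat) (T : R) (z : seq 'I_k) :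
  (0 < k)%N -> (0 < c)%N ->
  (size z)%:R <= (c ^ 2 * k)%:R / 2 - k%:R * c%:R * T ->
  #|tuples_in (c ^ 2) z|%:R <= (k ^ (c ^ 2))%:R * expR (1 - T).
Proof.
move=> k0 c0 zL.
have k0' : 0 < k%:R :> R by rewrite ltr0n.
have c0' : 0 < c%:R :> R by rewrite ltr0n.
(* With blocks of length [c^2], this is the largest order of the exponent that keeps
   the second-order error of the moment bound at most [c^2 * (l * k)^2 = 1]. *)
pose l : R := (k%:R * c%:R)^-1.
have l0 : 0 < l by rewrite invr_gt0 mulr_gt0.
pose x := expR (- l).
have x01 : 0 <= x <= 1 by rewrite expR_ge0 -expR0 ler_expR oppr_le0 ltW.
have := card_tuples_in_exp (c ^ 2) z x01; rewrite card_ord.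
have -> : x ^+ size z = expR (- (l * (size z)%:R)) by rewrite -expRM_natl mulrN mulrC.
rewrite -ler_pdivlMr ?expR_gt0 // -expRN opprK => /le_trans; apply.
(* Apply the quadratic bound to each term with its error taken at [j.+1 = k]; the linear terms
   average to at least [l * k / 2], and [1 + u <= expR u] closes. *)
have S1 : \sum_(j < k) x ^+ j.+1 <= k%:R * expR (- (l * k%:R / 2) + (l * k%:R) ^+ 2).
  apply: le_trans (_ : \sum_(j < k) (1 - l * j.+1%:R + (l * k%:R) ^+ 2) <= _).
    apply: ler_sum => j _; rewrite -expRM_natl mulrN mulrC.
    apply: le_trans (expRN_le_quadratic _) _; first by rewrite mulr_ge0 // ltW.
    rewrite lerD2l ler_sqr ?nnegrE ?mulr_ge0 ?(ltW l0) //.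
    by rewrite ler_pM2l // ler_nat.
  rewrite big_split sumrB /= !sumr_const card_ord -mulr_sumr.
  have -> : \sum_(j < k) j.+1%:R = k%:R * (k%:R + 1) / 2 :> R.
    elim: (k) => [|i IH]; first by rewrite big_ord0 !mul0r.
    by rewrite big_ord_recr /= IH -natr1; field.
  rewrite -[X in _ - _ + X <= _]mulr_natl.
  have := expR_ge1Dx (- (l * k%:R / 2) + (l * k%:R) ^+ 2).
  rewrite -(ler_pM2l k0') => /(le_trans _); apply.
  have := mulr_gt0 l0 k0'; nra.
apply: le_trans (_ : (k%:R * expR (- (l * k%:R / 2) + (l * k%:R) ^+ 2)) ^+ (c ^ 2)
    * expR (l * (size z)%:R) <= _).
  rewrite ler_pM2r ?expR_gt0 // lerXn2r // nnegrE ?mulr_ge0 ?expR_ge0 //.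
  by apply: sumr_ge0 => j _; rewrite exprn_ge0 // expR_ge0.
rewrite exprMn -natrX -[leLHS]mulrA ler_pM2l ?ltr0n ?expn_gt0 ?k0 //.
rewrite -expRM_natl -expRD ler_expR.
have -> : (l * k%:R) ^+ 2 = (c%:R ^+ 2)^-1.
  rewrite /l; field; lra.
have h : l * (size z)%:R <= l * ((c ^ 2 * k)%:R / 2 - k%:R * c%:R * T) by rewrite ler_pM2l.
apply: le_trans (lerD (lexx _) h) _.
rewrite natrM natrX le_eqVlt; apply/orP; left; apply/eqP; rewrite /l; field.
lra.
Qed.

Lemma expn_le_double_ffact (k b : nat) :
  (2 * b ^ 2 <= k)%N -> (k ^ b <= 2 * k ^_ b)%N.
Proof.
move=> bk; have [k0|k0] := posnP k.
  by rewrite k0; case: b bk => // b; rewrite exp0n.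
have bk' : (b <= k)%N by move: bk; rewrite -mulnn; nia.
(* This is [k ^ i * (1 - i * b / k) <= k ^_ i] with the division cleared; at [i = b] the loss
   [b ^ 2 / k] is at most one half. *)
have H i : (i <= b)%N -> (k ^ i * k <= k ^_ i * k + i * b * k ^ i)%N.
  elim: i => [|i IH] ib; first by rewrite ffactn0 expn0; lia.
  rewrite ffactnSr expnSr; have := IH (ltnW ib).
  set A := (k ^ i)%N; set F := (k ^_ i)%N => h.
  set d := (k - i)%N; have kE : k = (d + i)%N by lia.
  have h1 : (A * k * d <= F * d * k + i * b * A * d)%N by nia.
  have h2 : (i * (A * k) <= b * (A * k))%N by rewrite leq_mul2r ltnW ?orbT.
  have h3 : (i * b * A * d <= i * b * A * k)%N by rewrite leq_mul2l kE leq_addr orbT.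
  have h4 : (A * k * k = A * k * d + i * (A * k))%N by rewrite {2}kE; ring.
  have h5 : (i.+1 * b * (A * k) = i * b * A * k + b * (A * k))%N by ring.
  lia.
rewrite -(leq_pmul2r k0).
have := H b (leqnn b); set A := (k ^ b)%N; set F := (k ^_ b)%N => h.
have : (2 * b ^ 2 * A <= k * A)%N by rewrite leq_mul2r bk orbT.
rewrite -mulnn; nia.
Qed.

(** * The lower bound with a logarithmic error factor *)

Lemma universal_word_block_bound (R : realType) (k n c : nat) (w : n.-tuple 'I_k) :
  (1 < k)%N -> (0 < c)%N -> (2 * c ^ 4 <= k)%N -> n%:R < k%:R ^+ 2 / 2 :> R ->
  (forall tau : 'S_k, bidirectional_circular_pattern w tau) ->
  (k %/ c ^ 2)%:R * ((c ^ 2 * k)%:R / 2 - k%:R * c%:R * (9 * ln k%:R)) <= n%:R :> R.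
Proof.
move=> k1 c0 ck nk univ; set T := 9 * _; set B := _ - _; set b := (c ^ 2)%N.
set m := (k %/ b)%N.
have [B0|B0] := ltP B 0.
  by apply: le_trans (ler0n _ _); rewrite mulr_ge0_le0 ?ler0n // ltW.
have k0 : (0 < k)%N by apply: ltnW.
have k2 : 2 <= k%:R :> R by rewrite ler_nat.
have k0' : 0 < k%:R :> R by lra.
set M := Num.truncn ((k ^ b)%:R * expR (1 - T)).
apply: le_trans (_ : (m * (Num.truncn B).+1)%:R <= _).
  by rewrite natrM ler_wpM2l ?ler0n // ltW // truncnS_gt.
rewrite ler_nat; apply: (@universal_word_size k n b m _ M w) => //.
- exact: leq_trunc_div.
- move=> z zB; rewrite truncn_ge_nat ?mulr_ge0 ?expR_ge0 //.
  apply: card_short_tuples_in => //; apply: le_trans (_ : (Num.truncn B)%:R <= _).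
    by rewrite ler_nat.
  by rewrite truncn_le.
rewrite -(ltr_nat R) !natrM.
(* Since [1 <= 2 * ln k], the 9 in [T] leaves a factor [k ^- 7]. The union bound spends at most
   [k ^ 5] of it ([E]), and the remaining [k ^- 2 <= 1 / 4] beats the factor 2 in [ff]. *)
have Mle : M%:R <= (k ^ b)%:R * (k%:R ^+ 7)^-1 :> R.
  apply: le_trans (_ : (k ^ b)%:R * expR (1 - T) <= _).
    by rewrite truncn_le mulr_ge0 ?expR_ge0.
  rewrite ler_pM2l ?ltr0n ?expn_gt0 ?k0 //.
  have -> : (k%:R ^+ 7)^-1 = expR (- (7 * ln k%:R)) :> R.
    by rewrite expRN expRM_natl lnK ?posrE.
  have lnk : 1 / 2 <= ln k%:R :> R.
    have := expR_ge1Dx (- ln k%:R : R); rewrite expRN lnK ?posrE // => h.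
    have : k%:R^-1 <= 2^-1 :> R by rewrite lef_pV2 ?posrE.
    lra.
  by rewrite ler_expR /T; lra.
have ff : (k ^ b)%:R <= 2 * (k ^_ b)%:R :> R.
  by rewrite -natrM ler_nat expn_le_double_ffact // -expnM.
have A0 : 0 < (k ^ b)%:R :> R by rewrite ltr0n expn_gt0 k0.
have mk : m%:R <= k%:R :> R by rewrite ler_nat leq_div.
have n0 := ler0n R n.
have E : m%:R * (((n + n)%:R) * n.+1%:R) <= k%:R ^+ 5 :> R.
  rewrite natrD -natr1 [leRHS](_ : _ = k%:R * (k%:R ^+ 2 * k%:R ^+ 2)); last by ring.
  apply: ler_pM => //.
  apply: ler_pM; [lra|lra|lra|nra].
apply: le_lt_trans (_ : k%:R ^+ 5 * ((k ^ b)%:R * (k%:R ^+ 7)^-1) < _).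
  rewrite mulrA; apply: ler_pM => //; by rewrite !mulr_ge0.
have -> : k%:R ^+ 5 * ((k ^ b)%:R * (k%:R ^+ 7)^-1) = (k ^ b)%:R / k%:R ^+ 2 :> R.
  by field; lra.
rewrite ltr_pdivrMr ?exprn_gt0 //.
have F0 : 0 < (k ^_ b)%:R :> R by lra.
have k4 : 4 <= k%:R ^+ 2 :> R by nra.
have := ler_wpM2l (ltW F0) k4; lra.
Qed.

(** For the maximal [c], [k < 2 * (c + 1) ^ 4 <= 32 * c ^ 4 <= 81 * c ^ 4]. *)
Lemma exists_fourth_root (k : nat) : (1 < k)%N ->
  exists c, [/\ (0 < c)%N, (2 * c ^ 4 <= k)%N & (k <= (3 * c) ^ 4)%N].
Proof.
move=> k1; pose P c := (2 * c ^ 4 <= k)%N.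
have P1 : P 1%N by rewrite /P exp1n.
have bnd c : P c -> (c <= k)%N.
  rewrite /P => h; case: (posnP c) => [->//|c0].
  by have := leq_pexp2l c0 (isT : 1 <= 4)%N; rewrite expn1; lia.
case: (ex_maxnP (ex_intro (fun c => P c) 1%N P1) bnd) => c Pc cmax; have c1 := cmax _ P1.
exists c; split => //; have : ~~ P c.+1 by apply/negP => /cmax; rewrite ltnn.
rewrite /P -ltnNge => h.
have h2 : (c.+1 ^ 4 <= (2 * c) ^ 4)%N by rewrite leq_exp2r //; lia.
have e4 : (81 * c ^ 4 = (3 * c) ^ 4)%N by rewrite expnMn.
have e5 : (16 * c ^ 4 = (2 * c) ^ 4)%N by rewrite expnMn.
by lia.
Qed.

Lemma universal_word_bound (R : realType) (k n : nat) (w : n.-tuple 'I_k) :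
  (0 < k)%N ->
  (forall tau : 'S_k, bidirectional_circular_pattern w tau) ->
  k%:R ^+ 2 / 2 - k%:R `^ (7 / 4) * (1 + 27 * ln k%:R) <= n%:R :> R.
Proof.
move=> k0 univ; have [k1|k1] := leqP k 1.
  have -> : k = 1%N by lia.
  by rewrite ln1 powR1 expr1n; apply: le_trans (ler0n _ _); lra.
(* A word of length at least [k ^ 2 / 2] satisfies the claim outright; otherwise [n] is small enough
   for the union bound. *)
have [nk|nk] := ltP n%:R (k%:R ^+ 2 / 2 : R); last first.
  apply: le_trans nk; rewrite gerBl mulr_ge0 ?powR_ge0 // addr_ge0 // mulr_ge0 //.
  by rewrite ln_ge0 // ler1n.
have [c [c0 ck kc]] := exists_fourth_root k1.
have := universal_word_block_bound k1 c0 ck nk univ; apply: le_trans.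
have lk : 0 <= ln k%:R :> R by rewrite ln_ge0 // ler1n.
set l := ln _ in lk *.
pose y : R := k%:R `^ (1 / 4).
have y0 : 0 <= y by apply: powR_ge0.
have y4 : k%:R = y ^+ 4 :> R.
  by rewrite -powR_mulrn // -powRrM mul1r mulVf // powRr1.
have -> : k%:R `^ (7 / 4) = y ^+ 7 :> R.
  by rewrite -powR_mulrn // -powRrM; congr (_ `^ _); field.
have c1 : 1 <= c%:R :> R by rewrite ler1n.
have cy : c%:R <= y.
  rewrite -(@ler_pXn2r _ 4) ?nnegrE //; rewrite -y4 -natrX ler_nat; lia.
have yc : y <= 3 * c%:R.
  rewrite -(@ler_pXn2r _ 4) ?nnegrE ?mulr_ge0 //.
  by rewrite -y4 -natrM -natrX ler_nat.
set m := (k %/ c ^ 2)%N.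
have m1 : m%:R * c%:R ^+ 2 <= k%:R :> R by rewrite -natrX -natrM ler_nat leq_trunc_div.
have m2 : k%:R <= m%:R * c%:R ^+ 2 + c%:R ^+ 2 :> R.
  by rewrite -natrX -natrM -natrD ler_nat {1}(divn_eq k (c ^ 2))
    leq_add2l ltnW // ltn_mod expn_gt0 c0.
have -> : m%:R * ((c ^ 2 * k)%:R / 2 - k%:R * c%:R * (9 * l)) =
   m%:R * c%:R ^+ 2 * k%:R / 2 - 9 * (m%:R * c%:R * k%:R) * l.
  by rewrite natrM natrX; field.
have yy1 : 1 <= y by apply: le_trans cy.
(* [P1] bounds the loss from rounding [k / c ^ 2] down, [P2] the deviation term, whose coefficient
   becomes [27 = 9 * 3]. *)
have P1 : c%:R ^+ 2 * k%:R <= y ^+ 7.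
  rewrite (_ : y ^+ 7 = y ^+ 2 * y * y ^+ 4); last by ring.
  rewrite -y4 ler_pM2r ?ltr0n // -[leLHS]mulr1 ler_pM ?exprn_ge0 //.
  by rewrite lerXn2r ?nnegrE.
have P2 : m%:R * c%:R * k%:R <= 3 * y ^+ 7.
  have h : m%:R * c%:R <= 3 * y ^+ 3.
    rewrite -(@ler_pM2r _ c%:R); last by lra.
    have -> : m%:R * c%:R * c%:R = m%:R * c%:R ^+ 2 :> R by ring.
    apply: le_trans m1 _; rewrite y4.
    have := ler_wpM2l (exprn_ge0 3 y0) yc; rewrite -exprSr; lra.
  have := ler_wpM2r (ler0n R k) h; rewrite {2}y4; lra.
have P3 := ler_wpM2r lk P2.
have P4 := ler_wpM2r (ler0n R k) m2.
have Y0 : 0 <= y ^+ 7 by apply: exprn_ge0.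
lra.
Qed.

(** * Absorbing the logarithm into the exponent, and the conclusion *)

Local Open Scope classical_set_scope.
Local Open Scope ring_scope.

Lemma cvg_div_sqrt_ln (R : realType) (a : R) :
  (a / Num.sqrt (ln k%:R)) @[k --> \oo] --> (0 : R).
Proof.
apply/cvgr0Pnorm_lt => e e0; near=> k.
have k1 : expR ((`|a| / e) ^+ 2) < k%:R by near: k; exact: nbhs_infty_gtr.
have k0 : 0 < k%:R :> R by apply: lt_trans k1; apply: expR_gt0.
have lk : (`|a| / e) ^+ 2 < ln k%:R by rewrite -ltr_expR lnK ?posrE.
have l0 : 0 < ln k%:R :> R by apply: le_lt_trans lk; apply: sqr_ge0.
have s0 : 0 < Num.sqrt (ln k%:R) :> R by rewrite sqrtr_gt0.
rewrite normrM normfV (gtr0_norm s0) ltr_pdivrMr // mulrC -ltr_pdivrMr //.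
have -> : `|a| / e = Num.sqrt ((`|a| / e) ^+ 2).
  by rewrite sqrtr_sqr [RHS]ger0_norm // divr_ge0 // ltW.
by rewrite ltr_sqrt.
Unshelve. all: by end_near. Qed.

(** With [s] the square root of [ln x], the right side is [expR (6 * s) ^+ 2 >= (1 + 6 * s) ^+ 2 >=
    1 + 27 * s ^+ 2]. *)
Lemma log_factor_le_powR (R : realType) (x : R) : 1 <= x ->
  1 + 27 * ln x <= x `^ (12 / Num.sqrt (ln x)).
Proof.
move=> x1; have l0 : 0 <= ln x by rewrite ln_ge0.
set s := Num.sqrt _; have s0 : 0 <= s by apply: sqrtr_ge0.
have ls : ln x = s ^+ 2 by rewrite sqr_sqrtr.
rewrite /powR gt_eqF; last by lra.
have -> : 12 / s * ln x = 2 * (6 * s).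
  rewrite ls; have [->|sn] := eqVneq s 0; first by ring.
  by field.
rewrite (_ : expR _ = expR (6 * s) ^+ 2); last by rewrite -expRM_natl.
rewrite ls; apply: le_trans (_ : (1 + 6 * s) ^+ 2 <= _); first by nra.
by rewrite lerXn2r ?nnegrE ?expR_ge0 ?expR_ge1Dx //; lra.
Qed.

Theorem mainTheorem4 (R : realType) :
  (exists K : nat, forall k : nat, (0 < k)%N -> (K <= k)%N ->
     ~ exists (n : nat) (sigma : n.-tuple 'I_k),
         [/\ (0 < n)%N,
             n%:R <= 3 / 8 * k%:R ^+ 2 + 1 / 2 :> R
           & forall tau : 'S_k, bidirectional_circular_pattern sigma tau])
  /\
  (exists eta : nat -> R,
     [/\ (forall k : nat, 0 <= eta k),
         eta k @[k --> \oo] --> (0 : R)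
       & forall k : nat, (0 < k)%N ->
           forall (n : nat) (sigma : n.-tuple 'I_k),
             (forall tau : 'S_k, bidirectional_circular_pattern sigma tau) ->
             n%:R >= k%:R ^+ 2 / 2 - k%:R `^ (7 / 4 + eta k) :> R]).
Proof.
(* The logarithmic factor is absorbed by [k `^ eta k = expR (12 * Num.sqrt (ln k))];
   at [k = 0] and [k = 1] division by zero gives [eta k = 0]. *)
pose eta (k : nat) : R := 12 / Num.sqrt (ln k%:R).
have eta0 k : 0 <= eta k by rewrite divr_ge0 // sqrtr_ge0.
have etacvg : eta k @[k --> \oo] --> (0 : R) by apply: cvg_div_sqrt_ln.
have lower k : (0 < k)%N -> forall (n : nat) (sigma : n.-tuple 'I_k),
    (forall tau : 'S_k, bidirectional_circular_pattern sigma tau) ->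
    k%:R ^+ 2 / 2 - k%:R `^ (7 / 4 + eta k) <= n%:R :> R.
  move=> k0 n sigma univ; apply: le_trans (universal_word_bound R k0 univ).
  rewrite lerD2l lerN2 powRD; last by rewrite pnatr_eq0 -lt0n k0 implybT.
  by rewrite ler_wpM2l ?powR_ge0 // log_factor_le_powR // ler1n.
split; last by exists eta.
(* Part (i) follows from the bound of (ii): for [eta k < 1 / 8] the error is at most [y ^+ 15] with
   [y = k ^ (1 / 8)]. As [y >= 9], this is at most [k ^ 2 / 9], less than the gap [k ^ 2 / 8]
   between 1/2 and 3/8 with enough room for the summand 1/2. *)
have [K _ hK] : \forall k \near \oo, eta k < 1 / 8 /\ 9 ^+ 8 < k%:R :> R.
  near=> k; split; last by near: k; exact: nbhs_infty_gtr.
  by apply: le_lt_trans (ler_norm _) _; near: k; apply: cvgr0_norm_lt.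
exists K => k k0 /hK[etak k9] [n [sigma [_ nk univ]]].
have := lower k k0 n sigma univ.
have k1 : 1 <= k%:R :> R by rewrite ler1n.
pose y : R := k%:R `^ (1 / 8).
have y0 : 0 <= y by apply: powR_ge0.
have y8 : y ^+ 8 = k%:R by rewrite -powR_mulrn // -powRrM mul1r mulVf // powRr1.
have y9 : 9 <= y by rewrite -(@ler_pXn2r _ 8) ?nnegrE // y8 ltW.
have ple : k%:R `^ (7 / 4 + eta k) <= y ^+ 15.
  rewrite -powR_mulrn // -powRrM; apply: ler_powR => //.
  lra.
have e : k%:R ^+ 2 = y * y ^+ 15 by rewrite -y8; ring.
have h : 9 * y ^+ 15 <= k%:R ^+ 2 by rewrite e ler_wpM2r // exprn_ge0.
have y1 : 1 <= y by apply: le_trans y9; rewrite ler1n.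
have h2 : 9 <= y ^+ 15 by apply: le_trans y9 _; apply: ler_eXnr.
lra.
Unshelve. all: by end_near. Qed.
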